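(* For every nonnegative integer $n$, $$\sum_{j=-\infty}^{\infty}(-1)^j\,pod(n-3j^2)=\sum_{j=-\infty}^{\infty}p\!\left(\frac n4-\frac{j(3j+1)}{8}\right),$$ where $p(x)=0$ if $x$ is not an integer.
   Context: $p(n)$ denotes the number of (unrestricted) partitions of $n$, with $p(0)=1$. $pod(n)$ denotes the number of partitions of $n$ in which odd parts are distinct and even parts may be repeated, with $pod(0)=1$. Both $p$ and $pod$ are $0$ at negative arguments. *)

(* Defs.v *)
From mathcomp Require Export all_boot all_order all_algebra.
From mathcomp Require Export classical_sets fsbigop.
From mathcomp Require Import zify lra.

Set Implicit Arguments.
Unset Strict Implicit.
Unset Printing Implicit Defensive.

Import Order.TTheory GRing.Theory Num.Theory.

Local Open Scope nat_scope.

Definition is_partition (n : nat) (s : seq nat) : bool :=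
  [&& sorted geq s, 0 \notin s & sumn s == n].

Definition odd_parts_distinct (s : seq nat) : bool :=
  uniq [seq x <- s | odd x].

(* The parts of a partition of n are at most n in number and in size, so all
   of its partitions occur among the sequences of type {bseq n of 'I_n.+1}. *)
Lemma is_partition_bseq (n : nat) (s : seq nat) :
  is_partition n s -> exists t : {bseq n of 'I_n.+1}, map val t = s.
Proof.
case/and3P=> _ s_pos /eqP s_sum.
have s_size : size s <= n.
  rewrite -s_sum; elim: s s_pos {s_sum} => //= x s IHs.
  by rewrite inE negb_or eq_sym -lt0n => /andP[x_gt0 /IHs s_le]; rewrite -add1n leq_add.
have s_le : all (fun x => x < n.+1) s.
  apply/allP => x; rewrite -s_sum ltnS; elim: s {s_pos s_sum s_size} => //= y s IHs.
  rewrite inE => /orP[/eqP-> | /IHs x_le]; first exact: leq_addr.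
  by rewrite (leq_trans x_le) ?leq_addl.
have sK : map val [seq inord x : 'I_n.+1 | x <- s] = s.
  rewrite -map_comp -[RHS]map_id; apply/eq_in_map => x /(allP s_le) x_lt.
  exact: inordK.
by exists (@Bseq n _ [seq inord x | x <- s] (eq_ind_r (leq^~ n) s_size (size_map _ s))).
Qed.

Definition nb_partitions (n : nat) : nat :=
  #|[pred s : {bseq n of 'I_n.+1} | is_partition n (map val s)]|.

Definition nb_pod_partitions (n : nat) : nat :=
  #|[pred s : {bseq n of 'I_n.+1} |
      is_partition n (map val s) && odd_parts_distinct (map val s)]|.

Definition pod (m : int) : nat :=
  if m is Posz n then nb_pod_partitions n else 0.

Definition p (x : rat) : nat :=
  if x \is a Num.int then
    if numq x is Posz n then nb_partitions n else 0
  else 0.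

(* The summands of both bilateral series vanish at negative arguments, hence
   for all but finitely many j, so that \sum_(j \in setT), which is 0 by
   convention on an infinite support, is the intended sum on both sides. *)
Local Open Scope ring_scope.

Lemma pod_lt0 (m : int) : m < 0 -> pod m = 0%N.
Proof. by case: m. Qed.

Lemma p_lt0 (x : rat) : x < 0 -> p x = 0%N.
Proof.
by rewrite /p -numq_lt0; case: ifP => // _; case: (numq x).
Qed.

Lemma pod_arg_lt0 (n : nat) (j : int) :
  (n < `|j|)%N -> n%:Z - 3 * j ^+ 2 < 0.
Proof. by move=> nj; nia. Qed.

Lemma p_arg_lt0 (n : nat) (j : int) :
  (n < `|j|)%N -> n%:Q / 4 - (j * (3 * j + 1))%:Q / 8 < 0.
Proof.
move=> nj; have : (2 * n%:Z < j * (3 * j + 1))%R by nia.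
rewrite -(ltr_int rat) intrM => ?; lra.
Qed.

(* Main.v *)
Require Import Defs.
From mathcomp Require Import zify ring qpoly.

Set Implicit Arguments.
Unset Strict Implicit.
Unset Printing Implicit Defensive.

Import Order.TTheory GRing.Theory Num.Theory.

Local Open Scope classical_set_scope.
Local Open Scope ring_scope.

(* Both sides are the coefficients of q^n in products of a theta series and a
   partition series.  With D(q) = prod (1 + q^k) and E(q) = prod (1 - q^k),
   splitting the parts by parity gives E(q^4) sum pod(n) q^n = D(q), while
   E(q^4) sum p(m) q^(4m) = 1.  The Jacobi triple product evaluates
   sum (-1)^j q^(3j^2) = E(q^3) / D(q^3), using Euler's identity between
   distinct and odd parts, and sum q^(j(3j+1)/2) = E(q^3) D(q) / D(q^3).
   Hence both products equal D(q) E(q^3) / (D(q^3) E(q^4)).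
   Truncated series are handled as elements of a commutative ring in which
   q is nilpotent, in the end Z[X]/(X^N): infinite products become finite
   and equal once they are long enough. *)

(** * Gaussian binomial coefficients *)

(** Defined by the Pascal recurrence rather than as a quotient, since [1 - q ^+ i] need not be
    invertible in [R]. *)
Fixpoint qbinom (R : comNzRingType) (q : R) (m k : nat) : R :=
  match m, k with
  | _, 0 => 1
  | 0, _.+1 => 0
  | m'.+1, k'.+1 => qbinom q m' k' + q ^+ k'.+1 * qbinom q m' k'.+1
  end.

Lemma qbinom0r (R : comNzRingType) (q : R) (m : nat) : qbinom q m 0 = 1.
Proof. by case: m. Qed.

Lemma qbinomS (R : comNzRingType) (q : R) (m k : nat) :
  qbinom q m.+1 k.+1 = qbinom q m k + q ^+ k.+1 * qbinom q m k.+1.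
Proof. by []. Qed.

Lemma qbinom_small (R : comNzRingType) (q : R) (m k : nat) :
  (m < k)%N -> qbinom q m k = 0.
Proof.
elim: m k => [|m IHm] [|k] //; rewrite ltnS => lt_mk.
by rewrite qbinomS !IHm ?mulr0 ?addr0 // ltnW.
Qed.

(** The mirror Pascal rule, by induction because the symmetry between k and m - k is not visible in
    the recurrence. Truncated subtraction is harmless: for m < k the factor [qbinom q m k] is 0. *)
Lemma qbinomS_sym (R : comNzRingType) (q : R) (m k : nat) :
  qbinom q m.+1 k.+1 = qbinom q m k.+1 + q ^+ (m - k) * qbinom q m k.
Proof.
elim: m k => [|m IHm] k; first by case: k => [|k]; rewrite /= ?subnn; ring.
rewrite qbinomS; case: k => [|k].
  have := IHm 0%N; rewrite !subn0 !qbinom0r => IH0.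
  rewrite {1}IH0 qbinomS qbinom0r !exprS; ring.
have [lt_mk|le_km] := ltnP m k.+1.
  rewrite (qbinom_small _ (_ : m.+1 < k.+2)%N) //.
  move: lt_mk; rewrite ltnS leq_eqVlt => /orP[/eqP->|lt_mk]; first by rewrite subnn; ring.
  by rewrite (qbinom_small _ (_ : m.+1 < k.+1)%N) //; ring.
rewrite {1}(IHm k) {1}(IHm k.+1) (qbinomS q m k.+1) (qbinomS q m k) subSS.
have -> : (m - k = (m - k.+1).+1)%N by lia.
rewrite !exprS; ring.
Qed.

Definition qpoch (R : comNzRingType) (q : R) (n : nat) : R :=
  \prod_(i < n) (1 - q ^+ i.+1).

Lemma qpochS (R : comNzRingType) (q : R) (n : nat) :
  qpoch q n.+1 = qpoch q n * (1 - q ^+ n.+1).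
Proof. by rewrite /qpoch big_ord_recr. Qed.

Lemma qbinom_qpoch (R : comNzRingType) (q : R) (m k : nat) :
  qbinom q (m + k) k * (qpoch q m * qpoch q k) = qpoch q (m + k).
Proof.
have qpoch0 : qpoch q 0 = 1 by rewrite /qpoch big_ord0.
have [s] := ubnP (m + k); elim: s m k => // s IHs [|m] [|k] lt_s.
- by rewrite /= qpoch0; ring.
- have := IHs 0%N k; rewrite !add0n qpoch0 !mul1r => IH.
  rewrite qbinomS (@qbinom_small _ q k k.+1) // mulr0 addr0 qpochS mulrA IH; last lia.
  by rewrite ?add0n -qpochS.
- by rewrite addn0 qbinom0r qpoch0; ring.
rewrite addSn qbinomS !qpochS.
have IH1 := IHs m.+1 k; have IH2 := IHs m k.+1.
have e1 : (m.+1 + k = m + k.+1)%N by lia.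
rewrite e1 !qpochS in IH1 IH2.
(* The last factor is split in two to match the two terms of the Pascal rule. *)
have -> : 1 - q ^+ (m + k.+1).+1 = (1 - q ^+ k.+1) + q ^+ k.+1 * (1 - q ^+ m.+1).
  rewrite mulrBr -exprD mulr1 (_ : k.+1 + m.+1 = (m + k.+1).+1)%N; [ring | lia].
rewrite [RHS]mulrDr -{1}IH1 ?mulrA; last lia.
rewrite -IH2; last lia.
ring.
Qed.

(** * Theta terms and the finite triple product *)

(** Since j(j + 1) is never negative, the absolute value only makes this a natural exponent;
    [tri (- j)] is j(j - 1)/2. *)
Definition tri (j : int) : nat := `|j * (j + 1)|./2.

Lemma triE (j : int) : (tri j)%:Z * 2 = j * (j + 1).
Proof.
have [k def_j] : exists k : int, j = k * 2 \/ j = k * 2 + 1.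
  exists (j %/ 2)%Z; have := divz_eq j 2; have := modz_ge0 j (isT : 2 != 0 :> int).
  have := ltz_mod j (isT : 2 != 0 :> int); lia.
have ge0 : 0 <= j * (j + 1) by nia.
have e : j * (j + 1) = 2 * (if j == k * 2 then k * (2 * k + 1) else (2 * k + 1) * (k + 1)).
  by case: eqP => H; nia.
rewrite /tri e; set t := (X in 2 * X); have t0 : 0 <= t by lia.
have -> : absz (2 * t) = (absz t * 2)%N by lia.
by rewrite muln2 doubleK; lia.
Qed.

(* For j ranging over the integers, these are the terms of Ramanujan's f(a, b),
   free of negative powers of a and b. *)
Definition theta_term (R : comNzRingType) (a b : R) (j : int) : R :=
  a ^+ tri j * b ^+ tri (- j).

Lemma theta_termN (R : comNzRingType) (a b : R) (j : int) :
  theta_term a b (- j) = theta_term b a j.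
Proof. by rewrite /theta_term opprK mulrC. Qed.

(** Formally, consecutive theta terms have ratio a(ab)^j. The extra power (ab)^m, with m - j a
    natural number, avoids negative exponents. *)
Lemma theta_term_shift (R : comNzRingType) (a b : R) (m l : nat) (j : int) :
  l%:Z = m%:Z - j ->
  a * (a * b) ^+ m * theta_term a b j = (a * b) ^+ l * theta_term a b (j + 1).
Proof.
move=> def_l; rewrite /theta_term !exprMn.
have t1 := triE j; have t2 := triE (j + 1); have t3 := triE (- j).
have t4 := triE (- (j + 1)).
have ea : (m.+1 + tri j = l + tri (j + 1))%N by nia.
have eb : (m + tri (- j) = l + tri (- (j + 1)))%N by nia.
transitivity (a ^+ (m.+1 + tri j) * b ^+ (m + tri (- j))).
  by rewrite !exprD exprS; ring.
by rewrite ea eb !exprD; ring.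
Qed.

Lemma theta_term_shiftN (R : comNzRingType) (a b : R) (m l : nat) (j : int) :
  l%:Z = m%:Z + j ->
  b * (a * b) ^+ m * theta_term a b j = (a * b) ^+ l * theta_term a b (j - 1).
Proof.
move=> def_l; have := @theta_term_shift R b a m l (- j).
rewrite !(mulrC b a) opprK => /(_ def_l).
by rewrite theta_termN => ->; rewrite -theta_termN opprD opprK.
Qed.

Lemma theta_term0 (R : comNzRingType) (a b : R) : theta_term a b 0 = 1.
Proof. by rewrite /theta_term oppr0 /tri mul0r !expr0 mulr1. Qed.

(* Cauchy's finite form of the Jacobi triple product. *)
Lemma finite_triple_product (R : comNzRingType) (a b : R) (m n : nat) :
  (\prod_(i < m) (1 + a * (a * b) ^+ i)) * (\prod_(i < n) (1 + b * (a * b) ^+ i))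
  = \sum_(k < (m + n).+1) qbinom (a * b) (m + n) k * theta_term a b (k%:Z - n%:Z).
Proof.
elim: n => [|n IHn]; last first.
  (* With j = k - n, the new factor contributes b(ab)^n theta_j = (ab)^k theta_(j-1), which is the
     second term of the Pascal rule; the first term reproduces the old sum. *)
  rewrite big_ord_recr mulrA IHn mulrDr mulr1 addnS /=.
  rewrite [RHS]big_ord_recl /=.
  under [X in _ = _ + X]eq_bigr => k _.
    rewrite mulrDl /bump add1n; over.
  rewrite big_split /= addrCA; congr (_ + _).
    apply: eq_bigr => k _; congr (_ * theta_term _ _ _); lia.
  rewrite [X in _ = _ + X]big_ord_recr /= qbinom_small // mulr0 mul0r addr0.
  rewrite [in LHS]big_ord_recl mulrDl qbinom0r !mul1r mulr_suml; congr (_ + _).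
    rewrite mulrC (@theta_term_shiftN _ _ _ _ 0); last by rewrite /=; lia.
    rewrite expr0 mul1r; congr (theta_term _ _ _); rewrite /=; lia.
  apply: eq_bigr => k _; rewrite /= /bump add1n.
  rewrite -mulrA [_ * (b * _)]mulrC (@theta_term_shiftN _ _ _ _ k.+1); last lia.
  rewrite mulrA [qbinom _ _ _ * _]mulrC; congr (_ * theta_term _ _ _); lia.
(* For n = 0 the new factor acts by a(ab)^m theta_k = (ab)^(m-k) theta_(k+1), which calls for the
   mirror Pascal rule. *)
rewrite big_ord0 mulr1 addn0; elim: m => [|m IHm].
  by rewrite big_ord0 big_ord1 /= theta_term0 mul1r.
rewrite big_ord_recr /= IHm mulrDr mulr1 /=.
rewrite [RHS]big_ord_recl.
under [X in _ = _ + X]eq_bigr => k _.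
  rewrite /= /bump add1n -qbinomS qbinomS_sym mulrDl; over.
rewrite big_split /= addrA; congr (_ + _).
  rewrite [X in _ = _ + X]big_ord_recr /= qbinom_small // mul0r.
  rewrite [in LHS]big_ord_recl qbinom0r; congr (_ + _).
  rewrite addr0; apply: eq_bigr => k _; congr (qbinom _ _ _ * theta_term _ _ _); rewrite /=; lia.
rewrite mulr_suml; apply: eq_bigr => k _.
rewrite -mulrA [_ * (a * _)]mulrC (@theta_term_shift _ _ _ _ (m - k)); last first.
  by have := ltn_ord k; lia.
rewrite mulrA [qbinom _ _ _ * _]mulrC; congr (_ * theta_term _ _ _); lia.
Qed.

(** * Nilpotent arguments and the triple product *)

Lemma prod_stable (R : comNzRingType) (N n : nat) (f : nat -> R) :
  (N <= n)%N -> (forall i, (N <= i)%N -> f i = 1) ->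
  \prod_(i < n) f i = \prod_(i < N) f i.
Proof.
move=> le_Nn f1; rewrite -(subnKC le_Nn) big_split_ord /=.
by rewrite [X in _ * X]big1 ?mulr1 // => i _; rewrite f1 ?leq_addr.
Qed.

Lemma expr_nilp (R : comNzRingType) (x : R) (N n : nat) :
  x ^+ N = 0 -> (N <= n)%N -> x ^+ n = 0.
Proof. by move=> x0 le_Nn; rewrite -(subnKC le_Nn) exprD x0 mul0r. Qed.

Lemma qpoch_stable (R : comNzRingType) (q : R) (N n : nat) :
  q ^+ N = 0 -> (N <= n)%N -> qpoch q n = qpoch q N.
Proof.
move=> qN le_Nn; apply: (prod_stable (f := fun i => 1 - q ^+ i.+1)) => // i le_Ni.
by rewrite (expr_nilp qN) ?subr0 // ltnW.
Qed.

Lemma geometric_nilp (R : comNzRingType) (x : R) (n : nat) :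
  x ^+ n = 0 -> (\sum_(i < n) x ^+ i) * (1 - x) = 1.
Proof.
by move=> xn; rewrite mulrC -[1 - x]opprB mulNr -subrX1 xn opprB subr0.
Qed.

(** Each factor [1 - q ^+ i.+1] has a finite geometric series as inverse. This replaces division by
    [qpoch] in what follows. *)
Lemma qpoch_lreg (R : comNzRingType) (q : R) (N n : nat) :
  q ^+ N = 0 -> GRing.lreg (qpoch q n).
Proof.
move=> qN; rewrite /qpoch.
elim/big_ind: _ => [|x y|i _]; first exact: lreg1.
  exact: lregM.
have qiN : (q ^+ i.+1) ^+ N = 0 by rewrite -exprM mulnC exprM qN expr0n.
move=> x y eq_xy; rewrite -[x]mul1r -[y]mul1r -(geometric_nilp qiN).
by rewrite -!mulrA eq_xy.
Qed.

Lemma theta_term_nilp (R : comNzRingType) (a b : R) (N : nat) (j : int) :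
  a ^+ N = 0 -> b ^+ N = 0 -> (N < `|j|)%N -> theta_term a b j = 0.
Proof.
move=> aN bN lt_Nj; have t1 := triE j; have t2 := triE (- j).
have [j_ge0|j_lt0] := lerP 0 j.
  by rewrite /theta_term (expr_nilp aN) ?mul0r //; nia.
by rewrite /theta_term (expr_nilp bN) ?mulr0 //; nia.
Qed.

Definition theta (R : comNzRingType) (a b : R) (N : nat) : R :=
  \sum_(k < (N + N).+1) theta_term a b (k%:Z - N%:Z).

(** Cauchy's form is applied with 2N factors of each kind. Terms with |j| > N vanish; for the others
    both k and 4N - k are at least N, so all values of [qpoch] in [qbinom_qpoch] coincide and the
    binomial times [qpoch (a * b) N] is 1. *)
Lemma triple_product (R : comNzRingType) (a b : R) (N : nat) :
  a ^+ N = 0 -> b ^+ N = 0 ->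
  theta a b (N + N) = qpoch (a * b) N *
    \prod_(i < N) ((1 + a * (a * b) ^+ i) * (1 + b * (a * b) ^+ i)).
Proof.
move=> aN bN; have abN : (a * b) ^+ N = 0 by rewrite exprMn aN mul0r.
have stable c : \prod_(i < N) (1 + c * (a * b) ^+ i)
    = \prod_(i < N + N) (1 + c * (a * b) ^+ i).
  rewrite [RHS](@prod_stable _ N _ (fun i => 1 + c * (a * b) ^+ i)) ?leq_addr //.
  by move=> i le_Ni; rewrite (expr_nilp abN) // mulr0 addr0.
rewrite big_split /= !stable finite_triple_product mulr_sumr.
apply: eq_bigr => k _; have [lt_Nk|le_kN] := ltnP N `|k%:Z - (N + N)%:Z|.
  by rewrite (theta_term_nilp aN bN lt_Nk) !mulr0.
have le_k4 : (k <= N + N + (N + N))%N by rewrite -ltnS.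
have := qbinom_qpoch (a * b) (N + N + (N + N) - k) k; rewrite subnK //.
rewrite !(qpoch_stable abN) ?mulrA => [|| |]; [|lia..].
set E := qpoch _ _; set c := qbinom _ _ _ => e.
have {}e : E * (E * c) = E * 1 by rewrite mulr1 -[RHS]e; ring.
by rewrite (qpoch_lreg abN e) mul1r.
Qed.

(** * Generating products of partitions *)

(** Turns distinctness into separate conditions on the multiplicity of each part, as a generating
    product requires. *)
Lemma odd_parts_distinctE (s : seq nat) :
  odd_parts_distinct s = all (fun x => odd x ==> (count_mem x s <= 1)%N) s.
Proof.
have count_odd x : odd x -> count_mem x [seq y <- s | odd y] = count_mem x s.
  move=> odd_x; rewrite count_filter; apply: eq_count => y /=.
  by case: eqP => // ->; rewrite odd_x.
apply/idP/allP => [s_uniq x _|le1].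
  by apply/implyP => /count_odd <-; rewrite count_uniq_mem // leq_b1.
apply/count_mem_uniq => x; rewrite mem_filter.
have [odd_x|even_x] := boolP (odd x); last first.
  by apply/count_memPn; rewrite mem_filter (negPf even_x).
rewrite count_odd //=; have [x_s|/count_memPn->//] := boolP (x \in s).
have := le1 x x_s; rewrite odd_x /= => le_c1; apply/eqP.
by rewrite eqn_leq le_c1 -has_count has_pred1.
Qed.

Lemma sumn_count (B : nat) (s : seq nat) :
  0%N \notin s -> all (fun x => (x <= B)%N) s ->
  sumn s = (\sum_(k < B) k.+1 * count_mem k.+1 s)%N.
Proof.
elim: s => [|x s IHs] /=; first by rewrite big1 // => k _; rewrite muln0.
rewrite inE negb_or => /andP[x_neq0 /IHs{IHs}IHs] /andP[le_xB /IHs->].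
under [RHS]eq_bigr => k _ do rewrite mulnDr.
rewrite [RHS]big_split /=; congr (_ + _)%N.
case: x x_neq0 le_xB => // x _ lt_xB.
rewrite (bigD1 (Ordinal lt_xB)) //= eqxx muln1 big1 ?addn0 // => k /eqP neq_kx.
by case: eqP => [[e]|_]; [case: neq_kx; apply: val_inj | rewrite muln0].
Qed.

Lemma sorted_geq_count_inj (s t : seq nat) :
  sorted geq s -> sorted geq t -> (forall x, count_mem x s = count_mem x t) -> s = t.
Proof.
move=> s_sorted t_sorted eq_st.
apply: (sorted_eq (leT := geq)) => //.
- by move=> x y z /= le_xy le_zx; apply: leq_trans le_xy.
- by move=> x y; rewrite /= andbC; apply: anti_leq.
by apply/allP => x _; rewrite /= (eq_st x).
Qed.

Lemma is_partition_multiplicities (B : nat) (f : 'I_B -> nat) :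
  exists s, is_partition (\sum_(k < B) k.+1 * f k) s /\
    forall k : 'I_B, count_mem k.+1 s = f k.
Proof.
pose t := flatten [seq nseq (f k) k.+1 | k : 'I_B].
have count_t x : count_mem x t = (\sum_(k < B) (k.+1 == x) * f k)%N.
  rewrite /t count_flatten -map_comp sumnE big_map big_enum /=.
  by apply: eq_bigr => k _; rewrite /= count_nseq.
exists (sort geq t); split; last first.
  move=> k; rewrite count_sort count_t (bigD1 k) //= eqxx mul1n big1 ?addn0 //.
  by move=> i /eqP neq_ik; case: eqP => // -[/val_inj].
apply/and3P; split.
- by apply: sort_sorted => x y; apply: leq_total.
- by rewrite mem_sort -has_pred1 has_count count_t big1.
rewrite (perm_sumn (permEl (perm_sort geq t))) sumn_flatten -map_comp sumnE big_map.
by rewrite big_enum /=; apply/eqP/eq_bigr => k _; rewrite /= sumn_nseq.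
Qed.

(** The bijection [g] sends a partition to its multiplicities. Only parts that occur are constrained
    on the left, all sizes up to B on the right; [c x 0] reconciles the two. *)
Lemma card_partitions_multiplicities (c : nat -> pred nat) (n B : nat) :
  (n <= B)%N -> (forall x, c x 0%N) ->
  #|[pred s : {bseq n of 'I_n.+1} | is_partition n (map val s)
      && all (fun x => c x (count_mem x (map val s))) (map val s)]|
  = #|[pred f : {ffun 'I_B -> 'I_B.+1} |
      (f \in family (fun k : 'I_B => [pred i : 'I_B.+1 | c k.+1 i]))
      && (\sum_(k < B) k.+1 * f k == n)%N]|.
Proof.
move=> le_nB c0; set S := LHS.
pose g (s : {bseq n of 'I_n.+1}) : {ffun 'I_B -> 'I_B.+1} :=
  [ffun k : 'I_B => inord (count_mem k.+1 (map val s))].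
have gE (s : {bseq n of 'I_n.+1}) k : g s k = count_mem k.+1 (map val s) :> nat.
  rewrite ffunE inordK // ltnS; apply: leq_trans le_nB.
  by rewrite (leq_trans (count_size _ _)) // size_map size_bseq.
have le_B (s : {bseq n of 'I_n.+1}) : all (fun x => (x <= B)%N) (map val s).
  by apply/allP => x /mapP[y _ ->]; rewrite (leq_trans _ le_nB) // -ltnS ltn_ord.
rewrite {}/S -(@card_in_imset _ _ g); last first.
  move=> s t /andP[/and3P[s_sorted s0 _] _] /andP[/and3P[t_sorted t0 _] _] eq_g.
  apply/val_inj/(inj_map val_inj)/sorted_geq_count_inj => // -[|x].
    by rewrite (count_memPn s0) (count_memPn t0).
  have [lt_xB|le_Bx] := ltnP x B.
    by have := gE s (Ordinal lt_xB); rewrite eq_g gE.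
  have not_mem (u : {bseq n of 'I_n.+1}) : x.+1 \notin map val u.
    by apply: contraL le_Bx => /(allP (le_B u)); rewrite -ltnNge.
  by rewrite (count_memPn (not_mem s)) (count_memPn (not_mem t)).
apply: eq_card => f; rewrite !inE; apply/imsetP/andP => [[s]|].
  rewrite inE => /andP[/and3P[_ s0 /eqP s_sum] /allP s_c] ->; split.
    apply/familyP => k; rewrite inE gE.
    have [/s_c//|/count_memPn->] := boolP (k.+1 \in map val s); exact: c0.
  by rewrite -[X in _ == X]s_sum (sumn_count s0 (le_B s)); apply/eqP/eq_bigr => k _;
    rewrite gE.
case=> /familyP f_c /eqP f_sum.
have [s [s_part s_count]] := is_partition_multiplicities (fun k => f k : nat).
rewrite f_sum in s_part; have [t def_s] := is_partition_bseq s_part.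
exists t; last by apply/ffunP => k; apply: val_inj; rewrite /= gE def_s s_count.
rewrite inE def_s s_part; apply/allP => -[|x] s_x; first by case/and3P: s_part; rewrite s_x.
have lt_xB : (x < B)%N by have := allP (le_B t) x.+1; rewrite def_s; apply.
by have := f_c (Ordinal lt_xB); rewrite inE -s_count.
Qed.

(** Serves to regroup an expanded product by weight: weights above B contribute 0. *)
Lemma expr_truncate (R : comNzRingType) (q : R) (B w : nat) :
  q ^+ B.+1 = 0 -> q ^+ w = \sum_(n < B.+1 | w == n) q ^+ n.
Proof.
move=> qB; have [lt_wB|le_Bw] := ltnP w B.+1.
  by rewrite (big_pred1 (Ordinal lt_wB)).
rewrite (expr_nilp qB) // big1 // => n /eqP def_w.
by have := ltn_ord n; rewrite -def_w ltnNge le_Bw.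
Qed.

(** Expanding the product chooses a multiplicity i for every part k + 1, hence a multiplicity
    function; the terms are then collected by weight. *)
Lemma partition_series (R : comNzRingType) (q : R) (B : nat) (c : nat -> pred nat) :
  q ^+ B.+1 = 0 -> (forall x, c x 0%N) ->
  \sum_(n < B.+1)
    #|[pred s : {bseq n of 'I_n.+1} | is_partition n (map val s)
        && all (fun x => c x (count_mem x (map val s))) (map val s)]|%:R * q ^+ n
  = \prod_(k < B) \sum_(i < B.+1 | c k.+1 i) q ^+ (k.+1 * i).
Proof.
move=> qB c0; rewrite bigA_distr_big_dep /=.
under [RHS]eq_bigr => f _.
  rewrite prodrXr (expr_truncate _ qB); over.
rewrite (exchange_big_dep predT) //=; apply: eq_bigr => n _.
rewrite (@card_partitions_multiplicities c n B) ?c0 -1?ltnS //.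
by rewrite sumr_const mulr_natl.
Qed.

Lemma prod_ord_double (R : comNzRingType) (M : nat) (f : nat -> R) :
  \prod_(k < M.*2) f k = \prod_(k < M) (f k.*2 * f k.*2.+1).
Proof.
elim: M => [|M IHM]; first by rewrite !big_ord0.
by rewrite doubleS !big_ord_recr /= IHM mulrA.
Qed.

Lemma nb_partitions_series (R : comNzRingType) (q : R) (B : nat) :
  q ^+ B.+1 = 0 ->
  (\sum_(n < B.+1) (nb_partitions n)%:R * q ^+ n) * qpoch q B = 1.
Proof.
move=> qB.
have -> : \sum_(n < B.+1) (nb_partitions n)%:R * q ^+ n
    = \prod_(k < B) \sum_(i < B.+1) q ^+ (k.+1 * i).
  rewrite -(@partition_series _ q B (fun _ _ => true)) //; apply: eq_bigr => n _.
  congr (_%:R * _); apply: eq_card => s.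
  by rewrite !inE (all_predT (map val s)) andbT.
rewrite -big_split big1 //= => k _.
under eq_bigr => i _ do rewrite exprM.
by rewrite geometric_nilp // -exprM mulnC exprM qB expr0n.
Qed.

(** The parts 2k + 1 and 2k + 2 are paired, whence the even length. The odd part gives 1 + q^(2k+1);
    the geometric series of the even part cancels against 1 - q^(4k+4), leaving 1 + q^(2k+2). *)
Lemma nb_pod_partitions_series (R : comNzRingType) (q : R) (M : nat) :
  q ^+ M.*2.+1 = 0 ->
  (\sum_(n < M.*2.+1) (nb_pod_partitions n)%:R * q ^+ n) * qpoch (q ^+ 4) M
  = \prod_(k < M.*2) (1 + q ^+ k.+1).
Proof.
move=> qM.
have -> : \sum_(n < M.*2.+1) (nb_pod_partitions n)%:R * q ^+ n
    = \prod_(k < M.*2) \sum_(i < M.*2.+1 | odd k.+1 ==> (i <= 1)%N) q ^+ (k.+1 * i).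
  rewrite -(@partition_series _ q M.*2 (fun x i => odd x ==> (i <= 1)%N)) //.
    apply: eq_bigr => n _; congr (_%:R * _); apply: eq_card => s.
    by rewrite !inE odd_parts_distinctE.
  by move=> x; rewrite implybT.
rewrite (prod_ord_double _ (fun k => \sum_(i < _ | odd k.+1 ==> _) q ^+ (k.+1 * i))).
rewrite (prod_ord_double _ (fun k => 1 + q ^+ k.+1)) -big_split /=.
apply: eq_bigr => k _; rewrite /= !odd_double /=.
under [X in _ * X * _]eq_bigr => i _ do rewrite exprM.
have e : 1 - (q ^+ 4) ^+ k.+1 = (1 - q ^+ k.*2.+2) * (1 + q ^+ k.*2.+2).
  have -> : (q ^+ 4) ^+ k.+1 = q ^+ k.*2.+2 * q ^+ k.*2.+2.
    by rewrite -exprM -exprD; congr (_ ^+ _); lia.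
  ring.
rewrite e mulrA -[_ * _ * (1 - _)]mulrA geometric_nilp; last first.
  by rewrite -exprM mulnC exprM qM expr0n.
rewrite mulr1; congr (_ * _).
(* The index [k] excludes M = 0, so the range of i does contain 0 and 1. *)
case: M k qM {e} => [[]//|M] k _.
by rewrite doubleS big_mkcond /= 2!big_ord_recl big1 ?muln0 ?muln1 ?addr0.
Qed.

(** * Product evaluations of the two theta series *)

Lemma prodD1_stable (R : comNzRingType) (q : R) (N n : nat) :
  q ^+ N = 0 -> (N <= n)%N ->
  \prod_(i < n) (1 + q ^+ i.+1) = \prod_(i < N) (1 + q ^+ i.+1).
Proof.
move=> qN le_Nn; apply: (prod_stable (f := fun i => 1 + q ^+ i.+1)) => // i le_Ni.
by rewrite (expr_nilp qN) ?addr0 // ltnW.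
Qed.

Lemma qpoch_odd_even (R : comNzRingType) (q : R) (N : nat) :
  q ^+ N = 0 ->
  qpoch (q * q) N * (\prod_(i < N) (1 - q * (q * q) ^+ i)) = qpoch q N.
Proof.
move=> qN; rewrite -(@qpoch_stable _ _ _ N.*2 qN); last lia.
rewrite {2}/qpoch (prod_ord_double _ (fun k => 1 - q ^+ k.+1)) big_split /= mulrC.
by congr (_ * _); apply: eq_bigr => i _; rewrite -expr2 -exprM -?exprS;
   congr (1 - _ ^+ _); lia.
Qed.

(** After multiplication by [qpoch q N], the identity (1 - q^i)(1 + q^i) = 1 - q^(2i) reduces the
    claim to [qpoch_odd_even]. *)
Lemma euler_odd_distinct (R : comNzRingType) (q : R) (N : nat) :
  q ^+ N = 0 ->
  (\prod_(i < N) (1 + q ^+ i.+1)) * (\prod_(i < N) (1 - q * (q * q) ^+ i)) = 1.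
Proof.
move=> qN; apply: (qpoch_lreg (n := N) qN); rewrite mulr1 mulrA.
rewrite -[RHS](qpoch_odd_even qN); congr (_ * _).
rewrite /qpoch -big_split; apply: eq_bigr => i _ /=; rewrite exprMn; ring.
Qed.

(** The triple product yields [qpoch (q * q) N] times the square of the product over odd exponents:
    one copy completes it to [qpoch q N], the other cancels by Euler's identity. *)
Lemma theta_gauss (R : comNzRingType) (q : R) (N : nat) :
  q ^+ N = 0 ->
  theta (- q) (- q) (N + N) * (\prod_(i < N) (1 + q ^+ i.+1)) = qpoch q N.
Proof.
move=> qN; have NqN : (- q) ^+ N = 0 by rewrite exprNn qN mulr0.
rewrite (triple_product NqN NqN) mulrNN big_split /=.
under [X in _ * (X * _)]eq_bigr do rewrite mulNr.
under [X in _ * (_ * X)]eq_bigr do rewrite mulNr.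
rewrite mulrA (qpoch_odd_even qN) -mulrA [X in _ * X]mulrC.
by rewrite (euler_odd_distinct qN) mulr1.
Qed.

(** Here ab = q^3, so the triple product supplies the factors 1 + q^i with i congruent to 1 or 2
    modulo 3, and the extra product on the left supplies the multiples of 3. *)
Lemma theta_pentagonal (R : comNzRingType) (q : R) (N : nat) :
  q ^+ N = 0 ->
  theta (q ^+ 2) q (N + N) * (\prod_(i < N) (1 + (q ^+ 3) ^+ i.+1))
  = qpoch (q ^+ 3) N * \prod_(i < N) (1 + q ^+ i.+1).
Proof.
move=> qN; have q2N : (q ^+ 2) ^+ N = 0 by rewrite -exprM mulnC exprM qN expr0n.
rewrite (triple_product q2N qN) -exprSr -mulrA; congr (_ * _).
rewrite -(@prodD1_stable _ q N (N * 3)) //; last lia.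
rewrite -big_split /=; elim: N {qN q2N} => [|N IHN]; first by rewrite !big_ord0.
rewrite mulSn !addSn add0n !big_ord_recr /= IHN -!mulrA; congr (_ * _).
rewrite mulrCA; congr ((1 + _) * ((1 + _) * (1 + _)));
  rewrite -?exprM -?exprD -?exprS; congr (_ ^+ _); lia.
Qed.

Lemma pod_theta_identity (R : comNzRingType) (q : R) (N : nat) :
  q ^+ N = 0 ->
  theta (- q ^+ 3) (- q ^+ 3) (N + N)
    * (\sum_(n < N.*2.+1) (nb_pod_partitions n)%:R * q ^+ n)
  = theta (q ^+ 2) q (N + N)
    * (\sum_(n < N.+1) (nb_partitions n)%:R * (q ^+ 4) ^+ n).
Proof.
move=> qN.
have nilp k : (q ^+ k.+1) ^+ N = 0 by rewrite -exprM mulnC exprM qN expr0n.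
have q4N : (q ^+ 4) ^+ N.+1 = 0 by rewrite exprS nilp mulr0.
have q2N : q ^+ N.*2.+1 = 0 by rewrite (expr_nilp qN) //; lia.
have pod_eq := nb_pod_partitions_series q2N.
rewrite (prodD1_stable qN) in pod_eq; last lia.
have p_eq := nb_partitions_series q4N.
have gauss := theta_gauss (nilp 2).
have pent := theta_pentagonal qN.
have odd3 := euler_odd_distinct (nilp 2).
move: (\sum_(n < _) _) (\sum_(n < _) _) pod_eq p_eq => G P pod_eq p_eq.
move: (theta _ _ _) (theta _ _ _) gauss pent => T F gauss pent.
apply: (qpoch_lreg (n := N) (nilp 3)).
rewrite mulrCA [_ * P]mulrC pod_eq mulrCA [_ * G]mulrC p_eq mulr1.
(* Both sides are multiplied by 1, written as D(q^3) times its inverse, so that the two theta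
   evaluations apply. *)
rewrite -[LHS]mulr1 -[RHS]mulr1 -[X in _ * X = _]odd3 -[X in _ = _ * X]odd3.
rewrite !mulrA pent -gauss.
by rewrite [F * _ * _]mulrAC.
Qed.

(** * Extraction of coefficients *)

Lemma in_qpolyXn_coef (R : comNzRingType) (N n : nat) (f g : {poly R}) :
  (n < N)%N -> in_qpoly 'X^N f = in_qpoly 'X^N g -> f`_n = g`_n.
Proof.
move=> lt_nN eq_fg; apply/eqP; rewrite -subr_eq0 -coefB; apply/eqP.
have : in_qpoly 'X^N (f - g) = 0 by rewrite raddfB /= eq_fg subrr.
move/(congr1 val); rewrite /= /mk_monic size_polyXn monicXn andbT ltnS.
rewrite (leq_ltn_trans (leq0n _) lt_nN) => modfg.
rewrite (Pdiv.RingMonic.rdivp_eq (monicXn R N) (f - g)) modfg addr0.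
by rewrite coefMXn lt_nN.
Qed.

Lemma in_qpolyXn_nilp (R : comNzRingType) (N : nat) :
  (0 < N)%N -> in_qpoly 'X^N ('X : {poly R}) ^+ N = 0.
Proof.
move=> N_gt0; rewrite -rmorphXn; apply: val_inj.
rewrite /= /mk_monic size_polyXn monicXn andbT ltnS N_gt0.
by rewrite Pdiv.RingMonic.rmodpp ?monicXn.
Qed.

Lemma rmorph_theta (R S : comNzRingType) (f : {rmorphism R -> S}) (a b : R) (N : nat) :
  f (theta a b N) = theta (f a) (f b) N.
Proof.
by rewrite rmorph_sum; apply: eq_bigr => k _; rewrite rmorphM !rmorphXn.
Qed.

Lemma sum_int_interval (F : int -> int) (B : nat) :
  (forall j, (B < `|j|)%N -> F j = 0) ->
  \sum_(j \in (setT : set int)) F j = \sum_(k < (B + B).+1) F (k%:Z - B%:Z).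
Proof.
move=> F0; pose r := [seq k%:Z - B%:Z | k <- index_iota 0 (B + B).+1].
rewrite (fsbigE r) => [|||j _ j_r] //.
- under eq_bigl do rewrite in_setT.
  by rewrite big_map big_mkord.
- by rewrite map_inj_uniq ?iota_uniq // => i j; lia.
apply: F0; rewrite ltnNge; apply: contra j_r => le_jB.
by apply/mapP; exists (absz (j + B%:Z)); rewrite ?mem_index_iota; lia.
Qed.

(** The exponents j(j + 1)/2 and j(j - 1)/2 add up to j^2, which has the parity of j, so the theta
    term is (-1)^j X^(3j^2) and shifts coefficients by 3j^2. *)
Lemma pod_theta_term_coef (B n : nat) (j : int) : (n < B)%N ->
  (theta_term (- 'X^3) (- 'X^3) j
    * \sum_(m < B) (nb_pod_partitions m)%:R * 'X^m : {poly int})`_n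
  = (-1) ^ j * (pod (n%:Z - 3 * j ^+ 2))%:Z.
Proof.
move=> lt_nB; rewrite /theta_term -exprD.
have -> : (tri j + tri (- j) = `|j| * `|j|)%N.
  by have := triE j; have := triE (- j); nia.
rewrite exprNn -exprM.
have -> : (-1) ^+ (`|j| * `|j|) = ((-1) ^ j)%:P :> {poly int}.
  have -> : (-1) ^ j = (-1) ^+ `|j|%N :> int.
    by case: j => [k|k] //=; rewrite NegzE -exprnN -exprVn invrN1.
  by rewrite rmorphXn rmorphN1 -signr_odd oddM andbb signr_odd.
rewrite -mulrA coefCM coefXnM; congr (_ * _).
have [lt_n|le_n] := ltnP; first by rewrite pod_lt0 //; nia.
have -> : n%:Z - 3 * j ^+ 2 = (n - 3 * (`|j| * `|j|))%N by nia.
have lt_B : (n - 3 * (`|j| * `|j|) < B)%N := leq_ltn_trans (leq_subr _ _) lt_nB.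
rewrite coef_sum (bigD1 (Ordinal lt_B)) //=.
rewrite mulr_natl coefMn coefXn eqxx big1 ?addr0 ?natz // => m neq_m.
rewrite mulr_natl coefMn coefXn; case: eqP => // e; last by rewrite mul0rn.
by case/eqP: neq_m; apply: val_inj.
Qed.

Lemma p_quarter (d : nat) :
  p (d%:Q / 4) = if (4 %| d)%N then nb_partitions (d %/ 4) else 0%N.
Proof.
case: ifP => [/dvdnP[m ->]|dvdF].
  rewrite mulnK // PoszM intrM mulfK //.
  by rewrite /p intr_int numq_int.
rewrite /p; case: ifP => // /intrP[z def_z]; case/negP: (negbT dvdF).
have : d%:Q = (z * 4)%:~R by rewrite intrM -def_z divfK.
by move/intr_inj => def_d; apply/dvdnP; exists `|z|%N; lia.
Qed.

(** The theta term is X^e with e = j(3j + 1)/2, and the argument of [p] is (n - e)/4; a series in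
    X^4 has only coefficients at multiples of 4, matching the value 0 of [p] off the integers. *)
Lemma p_theta_term_coef (B n : nat) (j : int) : (n < B)%N ->
  (theta_term 'X^2 'X j
    * \sum_(m < B) (nb_partitions m)%:R * 'X^4 ^+ m : {poly int})`_n
  = (p (n%:Q / 4 - (j * (3 * j + 1))%:Q / 8))%:Z.
Proof.
move=> lt_nB; rewrite /theta_term -exprM -exprD.
set e := (2 * tri j + tri (- j))%N.
have def_e : j * (3 * j + 1) = (e * 2)%N%:Z.
  by have := triE j; have := triE (- j); rewrite /e; nia.
have -> : n%:Q / 4 - (j * (3 * j + 1))%:Q / 8 = (n%:Z - e%:Z)%:Q / 4.
  by rewrite def_e PoszM intrM intrB; field.
rewrite coefXnM; have [lt_ne|le_en] := ltnP.
  rewrite p_lt0 // pmulr_llt0 // (_ : 0 = 0%:~R) // ltr_int; lia.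
rewrite subzn // p_quarter coef_sum.
under eq_bigr => m _ do rewrite mulr_natl coefMn -exprM coefXn.
case: ifP => [/dvdnP[m def_m]|dvdF]; last first.
  rewrite big1 // => m _; case: eqP => [def_m|_]; last by rewrite mul0rn.
  by rewrite def_m dvdn_mulr in dvdF.
have lt_mB : (m < B)%N by lia.
rewrite (bigD1 (Ordinal lt_mB)) //= def_m mulnK // mulnC eqxx natz.
rewrite big1 ?addr0 // => i neq_i.
rewrite eqn_pmul2l //; case: eqP => [e_im|_]; last by rewrite mul0rn.
by case/eqP: neq_i; apply: val_inj.
Qed.

Lemma pod_theta_coef (N n : nat) : (n < N)%N ->
  (theta (- 'X^3) (- 'X^3) (N + N)
    * \sum_(m < N.*2.+1) (nb_pod_partitions m)%:R * 'X^m : {poly int})`_n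
  = (theta 'X^2 'X (N + N)
    * \sum_(m < N.+1) (nb_partitions m)%:R * 'X^4 ^+ m : {poly int})`_n.
Proof.
move=> lt_nN; apply: (in_qpolyXn_coef lt_nN).
(* Any morphism making X nilpotent carries the identity; reduction modulo X^N is one, and it
   preserves the coefficients below N. *)
have transfer (S : comNzRingType) (f : {rmorphism {poly int} -> S}) :
  f 'X ^+ N = 0 ->
  f (theta (- 'X^3) (- 'X^3) (N + N)
    * \sum_(m < N.*2.+1) (nb_pod_partitions m)%:R * 'X^m : {poly int})
  = f (theta 'X^2 'X (N + N)
    * \sum_(m < N.+1) (nb_partitions m)%:R * 'X^4 ^+ m : {poly int}).
  move=> fXN; rewrite !rmorphM !rmorph_theta !rmorphN !rmorphXn !rmorph_sum.
  under eq_bigr => m _ do rewrite rmorphM rmorph_nat rmorphXn.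
  under [in RHS]eq_bigr => m _ do rewrite rmorphM rmorph_nat !rmorphXn.
  exact: pod_theta_identity.
exact: transfer (in_qpolyXn_nilp int (leq_ltn_trans (leq0n n) lt_nN)).
Qed.

Theorem theorem4p11 (n : nat) :
  \sum_(j \in (setT : set int)) ((-1) ^ j * (pod (n%:Z - 3 * j ^+ 2))%:Z)
  = \sum_(j \in (setT : set int))
      (p (n%:Q / 4 - (j * (3 * j + 1))%:Q / 8))%:Z.
Proof.
have lt_B j : (n.+1 + n.+1 < `|j|)%N -> (n < `|j|)%N by lia.
(* The summands vanish once |j| > n; the wider interval is that of [theta _ _ (N + N)] with N = n +
   1. *)
rewrite (@sum_int_interval _ (n.+1 + n.+1)) => [|j /lt_B lt_j]; last first.
  by rewrite p_lt0 // p_arg_lt0.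
rewrite (@sum_int_interval _ (n.+1 + n.+1)) => [|j /lt_B lt_j]; last first.
  by rewrite pod_lt0 ?mulr0 // pod_arg_lt0.
have := pod_theta_coef (ltnSn n); rewrite !mulr_suml !coef_sum => eq_n.
etransitivity; [etransitivity; [|exact: eq_n]|]; apply: eq_bigr => k _.
  by rewrite pod_theta_term_coef //; lia.
by rewrite p_theta_term_coef.
Qed.
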